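(* Let $1<p<\infty$ and let $C_0$ be the discrete Cesàro operator on the complex Banach space $\ell^p$ (sequences indexed by $n=0,1,2,\dots$), $(C_0f)(n)=\frac{1}{n+1}\sum_{k=0}^n f(k)$. If $\lambda\in\mathbb C$ is an extended eigenvalue of $C_0$ on $\ell^p$, then $\lambda$ is real and $\lambda\ge 1$.
   Context: A complex scalar $\lambda$ is an extended eigenvalue of a bounded linear operator $T$ on a complex Banach space $E$ if there is a nonzero bounded linear operator $X$ on $E$ with $TX=\lambda XT$. It is a known fact that $C_0$ is bounded on $\ell^p$ for $1<p<\infty$. *)

(* Defs.v *)
From HB Require Import structures.
From mathcomp Require Import all_boot all_order all_algebra complex ring lra.
From mathcomp Require Import all_classical all_reals all_analysis.

Set Implicit Arguments.
Unset Strict Implicit.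
Unset Printing Implicit Defensive.
Import Order.TTheory GRing.Theory Num.Theory.
Import numFieldNormedType.Exports.
Local Open Scope ring_scope.

(* [R[i]] is the field of complex numbers over the reals [R]. Its order is
   partial ([x <= y] forces [x] and [y] to have the same imaginary part), and a
   [normedModType R[i]] has its norm valued in the nonnegative reals of [R[i]];
   [normc] is the modulus valued in [R]. *)
Notation normc := Normc.normc.

Section BoundedOperator.
Context {R : realType}.

Definition is_bounded_op (E : normedModType R[i]) (X : E -> E) : Prop :=
  exists M : R, forall f : E, `|X f| <= M%:C%C * `|f|.

Record bounded_op (E : normedModType R[i]) := BoundedOp {
  op_fun :> {linear E -> E};
  op_bounded : is_bounded_op op_fun
}.

Definition extended_eigenvalue (E : normedModType R[i]) (T : bounded_op E)
    (lambda : R[i]) : Prop :=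
  exists X : bounded_op E,
    (exists f : E, X f != 0) /\ forall f : E, T (X f) = lambda *: X (T f).

End BoundedOperator.

Section LpNorm.
Context {R : realType}.
Implicit Types (p : R) (a b : nat -> R) (f g : nat -> R[i]).
Local Open Scope ereal_scope.

Definition lpnorm p f : \bar R :=
  Lnorm counting p%:E (EFin \o (fun n => normc (f n))).

Lemma normc_ge0 (z : R[i]) : (0 <= normc z)%R.
Proof. by case: z => x y; exact: sqrtr_ge0. Qed.

Lemma normcD (x y : R[i]) : (normc (x + y) <= normc x + normc y)%R.
Proof. by rewrite -lecR rmorphD/=; exact: (@ler_normD _ R[i]). Qed.

Lemma lpnormE p f : (0 < p)%R ->
  lpnorm p f = (\sum_(0 <= k <oo) (normc (f k) `^ p)%:E) `^ p^-1.
Proof.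
move=> p0; rewrite /lpnorm Lnorm_counting//; congr (_ `^ _).
apply: eq_eseriesr => k _ /=.
by rewrite ger0_norm ?normc_ge0.
Qed.

Lemma lpnorm_ge0 p f : 0 <= lpnorm p f.
Proof. exact: Lnorm_ge0. Qed.

(* The hypothesis bounds the [p]-th powers: [K] is the [p]-th power of the
   resulting operator norm bound. *)
Lemma lpnorm_le p f g (K : R) : (0 < p)%R -> (0 <= K)%R ->
  (forall N, (\sum_(0 <= k < N) normc (f k) `^ p <=
     K * \sum_(0 <= k < N) normc (g k) `^ p)%R) ->
  lpnorm p f <= (K `^ p^-1)%:E * lpnorm p g.
Proof.
move=> p0 K0 fg; rewrite !lpnormE//.
have pos h k : 0 <= (normc (h k) `^ p)%:E by rewrite lee_fin powR_ge0.
rewrite -poweR_EFin -poweRM ?lee_fin// ?nneseries_ge0//.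
apply: gt0_ler_poweR.
- by rewrite invr_ge0 ltW.
- by rewrite in_itv/= leey andbT nneseries_ge0.
- by rewrite in_itv/= leey andbT mule_ge0 ?nneseries_ge0.
apply: lime_le; first exact: is_cvg_nneseries.
apply: nearW => N; rewrite sumEFin.
apply: (@le_trans _ _ (K%:E * (\sum_(0 <= k < N) normc (g k) `^ p)%R%:E)).
  by rewrite -EFinM lee_fin.
apply: lee_wpmul2l; rewrite ?lee_fin// -sumEFin; exact: nneseries_lim_ge.
Qed.

Lemma lpnormD p f g : (1 <= p)%R ->
  lpnorm p (f + g)%R <= lpnorm p f + lpnorm p g.
Proof.
move=> p1; have p0 : (0 < p)%R by lra.
apply: (@le_trans _ _ (Lnorm (@counting nat R) p%:E
  (EFin \o ((fun n => normc (f n)) \+ (fun n => normc (g n)))%R))); last first.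
  exact: minkowski_EFin.
rewrite lpnormE// Lnorm_counting//.
apply: gt0_ler_poweR.
- by rewrite invr_ge0 ltW.
- by rewrite in_itv/= leey andbT nneseries_ge0// => k _ _; rewrite lee_fin powR_ge0.
- by rewrite in_itv/= leey andbT nneseries_ge0// => k _ _; rewrite poweR_ge0.
apply: lee_nneseries => [k _ _|k _ /=]; first by rewrite lee_fin powR_ge0.
rewrite lee_fin; apply: ge0_ler_powR;
  [exact: ltW|by rewrite nnegrE normc_ge0|by rewrite nnegrE|].
rewrite ger0_norm ?addr_ge0 ?normc_ge0//.
exact: normcD.
Qed.

Lemma lpnormZ p (z : R[i]) f : (0 < p)%R ->
  lpnorm p (z *: f)%R = (normc z)%:E * lpnorm p f.
Proof.
move=> p0; rewrite !lpnormE//.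
under eq_eseriesr => k _.
  rewrite /= Normc.normcM powRM ?normc_ge0// EFinM; over.
rewrite nneseriesZl; last by move=> k _; rewrite lee_fin powR_ge0.
rewrite poweRM ?lee_fin ?powR_ge0//; last first.
  by apply: nneseries_ge0 => k _ _; rewrite lee_fin powR_ge0.
by rewrite poweR_EFin -powRrM divff ?gt_eqF// powRr1 ?normc_ge0.
Qed.

Lemma lpnorm0 p : (0 < p)%R -> lpnorm p 0%R = 0.
Proof. by move=> p0; rewrite -(scale0r 0) lpnormZ// Normc.normc0 mul0e. Qed.

Lemma lpnorm_coord p f n : (0 < p)%R -> (normc (f n))%:E <= lpnorm p f.
Proof.
move=> p0; rewrite lpnormE//.
have -> : (normc (f n))%:E = ((normc (f n) `^ p)%:E) `^ p^-1.
  by rewrite poweR_EFin -powRrM divff ?gt_eqF// powRr1 ?normc_ge0.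
have pos k : 0 <= (normc (f k) `^ p)%:E by rewrite lee_fin powR_ge0.
apply: gt0_ler_poweR.
- by rewrite invr_ge0 ltW.
- by rewrite in_itv/= leey andbT.
- by rewrite in_itv/= leey andbT nneseries_ge0.
rewrite (nneseriesD1 (n := n))// leeDl//.
exact: nneseries_ge0.
Qed.

End LpNorm.

Section LpSpace.
Context {R : realType} {p : R}.

(* The proof of [1 < p] is a parameter of the predicate only so that the vector
   space structure can be attached to it canonically. *)
Definition in_lp of 1 < p : {pred nat -> R[i]} :=
  fun f => (lpnorm p f < +oo)%E.

Variable p1 : 1 < p.

Let p_gt0 : 0 < p. Proof. exact: lt_trans p1. Qed.

Lemma in_lpE f : (f \in in_lp p1) = (lpnorm p f < +oo)%E.
Proof. by []. Qed.

Lemma in_lp_submod_closed : submod_closed (in_lp p1).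
Proof.
split=> [|z f g]; rewrite !in_lpE; first by rewrite lpnorm0.
move=> foo goo; apply: (le_lt_trans (lpnormD _ _ (ltW p1))).
rewrite lte_add_pinfty// lpnormZ// lte_mul_pinfty// ?lee_fin ?normc_ge0//.
Qed.

HB.instance Definition _ := GRing.isSubmodClosed.Build _ _ (in_lp p1)
  in_lp_submod_closed.

Record lp := Lp {
  lp_val :> nat -> R[i];
  lp_valP : lp_val \in in_lp p1
}.

HB.instance Definition _ := [isSub for lp_val].
HB.instance Definition _ := [Choice of lp by <:].
HB.instance Definition _ := [SubChoice_isSubLmodule of lp by <:].

Definition lp_norm (f : lp) : R[i] := (fine (lpnorm p f))%:C%C.

Lemma lpnorm_fin_num (f : lp) : lpnorm p f \is a fin_num.
Proof.
by rewrite ge0_fin_numE ?lpnorm_ge0// -in_lpE; exact: lp_valP.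
Qed.

Fact lp_ler_normD (f g : lp) : lp_norm (f + g) <= lp_norm f + lp_norm g.
Proof.
rewrite /lp_norm -rmorphD/= lecR -fineD ?lpnorm_fin_num//.
apply: fine_le; [exact: (lpnorm_fin_num (f + g))| |exact: (lpnormD _ _ (ltW p1))].
by rewrite fin_numD !lpnorm_fin_num.
Qed.

Fact lp_normrZ (z : R[i]) (f : lp) : lp_norm (z *: f) = `|z| * lp_norm f.
Proof.
rewrite /lp_norm lpnormZ// fineM ?lpnorm_fin_num// rmorphM/=.
by case: z.
Qed.

Fact lp_normr0_eq0 (f : lp) : lp_norm f = 0 -> f = 0.
Proof.
rewrite /lp_norm => /complexI nf0; apply/val_inj/funext => n /=.
apply: Normc.eq0_normc; apply/eqP; rewrite eq_le normc_ge0 andbT -lee_fin.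
by rewrite (le_trans (lpnorm_coord _ _ p_gt0))// -[leLHS]fineK ?lpnorm_fin_num// nf0.
Qed.

HB.instance Definition _ := Lmodule_isNormed.Build R[i] lp
  lp_ler_normD lp_normrZ lp_normr0_eq0.

Lemma lp_normE (f : lp) : `|f| = (fine (lpnorm p f))%:C%C.
Proof. by []. Qed.

End LpSpace.

Section Cesaro.
Context {R : realType} {p : R}.
Variable p1 : 1 < p.
Local Notation lp := (lp p1).

Let p_gt0 : 0 < p. Proof. exact: lt_trans p1. Qed.

Lemma powR_young (x y : R) : 0 <= x -> 0 <= y ->
  p * (x `^ (p - 1) * y) <= (p - 1) * x `^ p + y `^ p.
Proof.
move=> x0 y0; have pB1 : 0 < p - 1 by rewrite subr_gt0.
have := @conjugate_powR R (x `^ (p - 1)) y (p / (p - 1)) p (powR_ge0 _ _) y0.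
rewrite divr_gt0// -powRrM [(p - 1) * _]mulrC divfK ?gt_eqF//.
move=> /(_ isT p_gt0); have -> : (p / (p - 1))^-1 + p^-1 = 1.
  by rewrite invf_div -[X in _ + X]mul1r -mulrDl subrK divff ?gt_eqF.
move=> /(_ erefl) /(ler_wpM2l (ltW p_gt0)) /le_trans; apply.
rewrite mulrDr invf_div le_eqVlt; apply/orP; left; apply/eqP.
by field; rewrite !gt_eqF.
Qed.

(* Elliott's proof of Hardy's inequality: [x] and [y] are the averages of the
   first [n + 1] and [n] terms, and [a] is the last term. *)
Lemma hardy_step (x y a : R) (n : nat) : 0 <= x -> 0 <= y ->
  a = n.+1%:R * x - n%:R * y ->
  (p - 1) * x `^ p - p * (x `^ (p - 1) * a) <=
  n%:R * y `^ p - n.+1%:R * x `^ p.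
Proof.
move=> x0 y0 ->.
have xp : x `^ (p - 1) * x = x `^ p.
  rewrite -{2}[x]powRr1// -powRD ?subrK// implybE.
  by rewrite gt_eqF.
have := ler_wpM2l (ler0n R n) (powR_young x0 y0).
rewrite mulrBr [x `^ (p - 1) * (n.+1%:R * x)]mulrCA xp -natr1.
set u := x `^ p; set v := y `^ p; set w := x `^ (p - 1).
rewrite [w * (_ * y)]mulrCA; set z := w * y.
set m := n%:R; nra.
Qed.

(* Not the sharp constant [p / (p - 1)], but enough for boundedness. *)
Let c : R := 2 * p / (p - 1).

Let c_ge0 : 0 <= c.
Proof. by rewrite /c divr_ge0// ?mulr_ge0 ?ltW// subr_gt0. Qed.

Lemma hardy_absorb (x a : R) : 0 <= x -> 0 <= a ->
  p * (x `^ (p - 1) * a) <=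
  (p - 1) / 2 * x `^ p + (p - 1) / 2 * c `^ p * a `^ p.
Proof.
move=> x0 a0; have pB1 : 0 < p - 1 by rewrite subr_gt0.
have h2 : 0 <= (p - 1) / 2 by rewrite divr_ge0// ltW.
have powS (z : R) : 0 <= z -> z `^ (p - 1) * z = z `^ p.
  move=> z0; rewrite -{2}[z]powRr1// -powRD ?subrK// implybE.
  by rewrite gt_eqF.
have [xca|cax] := leP x (c * a).
  apply: (@le_trans _ _ ((p - 1) / 2 * c `^ p * a `^ p)); last first.
    by rewrite lerDr; exact: mulr_ge0 h2 (powR_ge0 _ _).
  rewrite -(powS c)// -(powS a)//.
  apply: (@le_trans _ _ (p * ((c * a) `^ (p - 1) * a))).
    rewrite ler_pM2l//; apply: ler_wpM2r => //.
    apply: ge0_ler_powR; rewrite ?nnegrE//; first exact: ltW.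
    exact: mulr_ge0.
  rewrite powRM// le_eqVlt; apply/orP; left; apply/eqP.
  rewrite /c; field; by rewrite gt_eqF.
apply: (@le_trans _ _ ((p - 1) / 2 * x `^ p)); last first.
  rewrite lerDl; apply: mulr_ge0; last exact: powR_ge0.
  exact: mulr_ge0 h2 (powR_ge0 _ _).
rewrite -(powS x)//; set w := x `^ (p - 1).
rewrite (mulrCA p) (mulrCA _ w); apply: ler_wpM2l.
  exact: powR_ge0.
apply: (@le_trans _ _ ((p - 1) / 2 * (c * a))).
  rewrite le_eqVlt; apply/orP; left; apply/eqP.
  rewrite /c; field; by rewrite gt_eqF.
by rewrite ler_pM2l ?ltW// divr_gt0.
Qed.

Lemma hardy_ineq (a : nat -> R) (N : nat) : (forall k, 0 <= a k) ->
  \sum_(0 <= n < N) ((\sum_(0 <= k < n.+1) a k) / n.+1%:R) `^ p <=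
  c `^ p * \sum_(0 <= n < N) a n `^ p.
Proof.
move=> a0; have pB1 : 0 < p - 1 by rewrite subr_gt0.
pose m n := (\sum_(0 <= k < n) a k) / n%:R.
have m0 n : 0 <= m n by rewrite divr_ge0// sumr_ge0.
have am n : a n = n.+1%:R * m n.+1 - n%:R * m n.
  rewrite /m !(mulrC _%:R) divfK ?pnatr_eq0//.
  case: n => [|n]; first by rewrite big_nat1 mulr0 subr0.
  by rewrite divfK ?pnatr_eq0// big_nat_recr//= addrAC subrr add0r.
have tel : \sum_(0 <= n < N)
    ((p - 1) * m n.+1 `^ p - p * (m n.+1 `^ (p - 1) * a n)) <= 0.
  apply: (@le_trans _ _ (\sum_(0 <= n < N)
      (n%:R * m n `^ p - n.+1%:R * m n.+1 `^ p))).
    by apply: ler_sum => n _; exact: hardy_step.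
  rewrite (eq_bigr (fun n => - (n.+1%:R * m n.+1 `^ p - n%:R * m n `^ p))).
    rewrite sumrN telescope_sumr// mul0r subr0 oppr_le0.
    by rewrite mulr_ge0 ?powR_ge0.
  by move=> n _; rewrite opprB.
have absb : \sum_(0 <= n < N) p * (m n.+1 `^ (p - 1) * a n) <=
    \sum_(0 <= n < N) ((p - 1) / 2 * m n.+1 `^ p +
                       (p - 1) / 2 * c `^ p * a n `^ p).
  by apply: ler_sum => n _; exact: hardy_absorb.
move: tel absb; rewrite sumrB big_split/= -!mulr_sumr.
rewrite -/(m _) => tel absb.
have h2 : 0 < (p - 1) / 2 by rewrite divr_gt0.
rewrite -(ler_pM2l h2) mulrA.
move: tel absb; set u := \sum_(_ <= _ < _) m _ `^ p; set v := p * _.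
set w := \sum_(_ <= _ < _) a _ `^ p; set d := c `^ p => tel absb.
have : (p - 1) * u = (p - 1) / 2 * u + (p - 1) / 2 * u by field.
lra.
Qed.

Definition cesaro_seq (f : nat -> R[i]) (n : nat) : R[i] :=
  (\sum_(0 <= k < n.+1) f k) / n.+1%:R.

Lemma lpnorm_cesaro (f : nat -> R[i]) :
  (lpnorm p (cesaro_seq f) <= c%:E * lpnorm p f)%E.
Proof.
have -> : c = (c `^ p) `^ p^-1.
  by rewrite -powRrM divff ?gt_eqF// powRr1.
apply: lpnorm_le => // [|N]; first exact: powR_ge0.
apply: le_trans (hardy_ineq N (fun k => normc_ge0 (f k))).
apply: ler_sum => n _; apply: ge0_ler_powR.
- exact: ltW.
- by rewrite nnegrE normc_ge0.
- by rewrite nnegrE divr_ge0// sumr_ge0// => k _; exact: normc_ge0.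
rewrite -lecR rmorphM/= fmorphV/= rmorph_nat rmorph_sum/=.
have normcE (z : R[i]) : (normc z)%:C%C = `|z| by [].
rewrite normcE normrM normfV normr_nat; apply: ler_wpM2r.
  by rewrite invr_ge0 ler0n.
exact: ler_norm_sum.
Qed.

Fact cesaro_subproof (f : lp) : cesaro_seq f \in in_lp p1.
Proof.
rewrite in_lpE; apply: (le_lt_trans (lpnorm_cesaro _)).
by rewrite lte_mul_pinfty ?lee_fin// -(in_lpE p1); exact: lp_valP.
Qed.

Definition cesaro_lp (f : lp) : lp := Lp (cesaro_subproof f).

Fact cesaro_lp_linear : linear cesaro_lp.
Proof.
move=> z f g; apply/val_inj/funext => n /=.
rewrite /cesaro_seq !fctE /= /cesaro_seq big_split/= mulrDl.
by rewrite -scaler_sumr scalerAl.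
Qed.

HB.instance Definition _ :=
  GRing.isLinear.Build R[i] lp lp *:%R cesaro_lp cesaro_lp_linear.

Fact cesaro_lp_bounded : is_bounded_op cesaro_lp.
Proof.
exists c => f; rewrite !lp_normE -rmorphM/= lecR.
have := lpnorm_cesaro f.
rewrite -[X in (X <= _)%E -> _](fineK (lpnorm_fin_num (cesaro_lp f))).
by rewrite -[X in (_ * X)%E](fineK (lpnorm_fin_num f)) -EFinM lee_fin.
Qed.

Definition cesaro_op : bounded_op lp := BoundedOp cesaro_lp_bounded.

Lemma cesaro_opE (f : lp) (n : nat) :
  cesaro_op f n = (\sum_(0 <= k < n.+1) f k) / n.+1%:R.
Proof. by []. Qed.

End Cesaro.

(* Main.v *)
(* For [Re w > kappa = 1 - 1/p] the sequence [g_w n = prod_(k <= n) (1 - w/k)]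
   lies in the dual of l^p and is an eigenvector of the transposed operator
   [C_0'] for [1/w]. If [C_0 X = lambda X C_0], then [X' g_w] is either zero or
   proportional to [g_(lambda w)], and the latter is not in the dual when
   [Re (lambda w) < kappa]. The coordinates [<X e_j, g_w>] are Newton series in
   [w], hence analytic on the half-plane [Re w > kappa], and they determine
   [X e_j] through their values at the positive integers, where the series
   terminate. So if [X <> 0], multiplication by [lambda] must send that
   half-plane into its closure, which forces [lambda] to be real and at least
   [1]. *)
Require Import Defs.
From mathcomp Require Import all_boot all_order all_algebra complex ring lra.
From mathcomp Require Import all_classical all_reals all_analysis.
Import Order.TTheory GRing.Theory Num.Theory.
Import numFieldNormedType.Exports.
Set Implicit Arguments.
Unset Strict Implicit.
Local Open Scope classical_set_scope.
Local Open Scope ring_scope.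

(** * Complex series *)

Section ComplexSeries.
Context {R : realType}.
Implicit Types (u v : nat -> R[i]) (z : R[i]) (B : R).

Lemma Re_le_normc z : `|complex.Re z| <= normc z.
Proof.
by case: z => a b /=; rewrite -sqrtr_sqr ler_sqrt ?lerDl ?sqr_ge0 ?addr_ge0 ?sqr_ge0.
Qed.

Lemma Im_le_normc z : `|complex.Im z| <= normc z.
Proof.
by case: z => a b /=; rewrite -sqrtr_sqr ler_sqrt ?lerDr ?sqr_ge0 ?addr_ge0 ?sqr_ge0.
Qed.

Lemma normc_le_ReIm z : normc z <= `|complex.Re z| + `|complex.Im z|.
Proof.
case: z => a b /=.
have ab : 0 <= `|a| + `|b| by rewrite addr_ge0.
rewrite -[leRHS](ger0_norm ab) -[leRHS]sqrtr_sqr ler_sqrt ?sqr_ge0//.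
rewrite sqrrD !real_normK ?num_real// addrAC lerDl.
by rewrite mulrn_wge0 ?mulr_ge0.
Qed.

Lemma normc_real (x : R) : normc x%:C%C = `|x|.
Proof. by rewrite /= expr0n addr0 sqrtr_sqr. Qed.

Lemma normcX z n : normc (z ^+ n) = normc z ^+ n.
Proof.
elim: n => [|n IHn]; first by rewrite !expr0 Normc.normc1.
by rewrite !exprS Normc.normcM IHn.
Qed.

Lemma normc_sum u (n : nat) :
  normc (\sum_(0 <= k < n) u k) <= \sum_(0 <= k < n) normc (u k).
Proof.
elim: n => [|n IHn]; first by rewrite !big_geq// Normc.normc0.
rewrite !big_nat_recr//=; apply: le_trans (normcD _ _) _.
by rewrite lerD2r.
Qed.

(** Real and imaginary parts are summed separately, so that only limits of real sequences occur; a
    divergent part gets the default value of [limn]. *)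
Definition csum u : R[i] :=
  Complex (limn (series (@complex.Re R \o u))) (limn (series (@complex.Im R \o u))).

Definition abs_sum_le u B := forall N, \sum_(0 <= n < N) normc (u n) <= B.

Lemma cvg_series_bound (a : nat -> R) B :
  (forall N, \sum_(0 <= n < N) `|a n| <= B) -> cvgn (series a).
Proof.
move=> aB; apply: normed_cvg; apply: nondecreasing_is_cvgn.
  by apply: nondecreasing_series => n _ _ /=.
by exists B => _ [n _ <-]; exact: aB.
Qed.

Lemma Re_sum u (n : nat) :
  complex.Re (\sum_(0 <= k < n) u k) = \sum_(0 <= k < n) complex.Re (u k).
Proof. by rewrite raddf_sum. Qed.

Lemma Im_sum u (n : nat) :
  complex.Im (\sum_(0 <= k < n) u k) = \sum_(0 <= k < n) complex.Im (u k).
Proof. by rewrite raddf_sum. Qed.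

Lemma csum_cvg u B : abs_sum_le u B ->
  (fun N => normc (\sum_(0 <= n < N) u n - csum u)) @ \oo --> (0 : R).
Proof.
move=> uB.
have cRe : cvgn (series (@complex.Re R \o u)).
  apply: (@cvg_series_bound _ B) => N; apply: le_trans (uB N).
  by apply: ler_sum => n _; exact: Re_le_normc.
have cIm : cvgn (series (@complex.Im R \o u)).
  apply: (@cvg_series_bound _ B) => N; apply: le_trans (uB N).
  by apply: ler_sum => n _; exact: Im_le_normc.
have h (a : nat -> R) : cvgn (series a) ->
    (fun N => `|series a N - limn (series a)|) @ \oo --> (0 : R).
  move=> ca; rewrite -(normr0 R); apply: cvg_norm.
  by rewrite -(subrr (limn (series a))); apply: cvgB => //; exact: cvg_cst.
apply: (@squeeze_cvgr _ _ _ _ (fun=> 0)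
  (fun N => `|series (@complex.Re R \o u) N - limn (series (@complex.Re R \o u))| +
            `|series (@complex.Im R \o u) N - limn (series (@complex.Im R \o u))|)).
- apply: nearW => N; rewrite normc_ge0/=.
  apply: le_trans (normc_le_ReIm _) _.
  by rewrite !raddfB/= Re_sum Im_sum.
- exact: cvg_cst.
- by rewrite -(addr0 0); apply: cvgD; exact: h.
Qed.

Lemma csum_unique u z :
  (fun N => normc (\sum_(0 <= n < N) u n - z)) @ \oo --> (0 : R) -> csum u = z.
Proof.
move=> uz; case: z uz => a b uz; rewrite /csum; congr Complex.
  apply/cvg_lim => //; apply/subr_cvg0/norm_cvg0P.
  apply: squeeze_cvgr uz; last exact: cvg_cst.
  apply: nearW => N; rewrite normr_ge0/=; apply: le_trans (Re_le_normc _).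
  by rewrite raddfB/= Re_sum.
apply/cvg_lim => //; apply/subr_cvg0/norm_cvg0P.
apply: squeeze_cvgr uz; last exact: cvg_cst.
apply: nearW => N; rewrite normr_ge0/=; apply: le_trans (Im_le_normc _).
by rewrite raddfB/= Im_sum.
Qed.

Lemma normc_csum_le u B : abs_sum_le u B -> normc (csum u) <= B.
Proof.
move=> uB; have := csum_cvg uB => cu.
apply/ler_addgt0Pr => e e0.
have [N _ lte] : \forall N \near \oo,
    normc (\sum_(0 <= n < N) u n - csum u) < e.
  by move/cvgr0Pnorm_lt: cu => /(_ e e0); apply: filterS => N;
     rewrite ger0_norm// normc_ge0.
move: (lte N (leqnn N)) => /= {}lte.
have := normcD (- (\sum_(0 <= n < N) u n - csum u)) 
  (\sum_(0 <= n < N) u n).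
rewrite opprB subrK => /le_trans; apply.
rewrite addrC; apply: lerD; first exact: le_trans (normc_sum _ _) (uB N).
by rewrite -opprB normcN ltW.
Qed.

Lemma csumD u v B B' : abs_sum_le u B -> abs_sum_le v B' ->
  csum (fun n => u n + v n) = csum u + csum v.
Proof.
move=> /csum_cvg cu /csum_cvg cv; apply: csum_unique.
apply: (@squeeze_cvgr _ _ _ _ (fun=> 0)
  (fun N => normc (\sum_(0 <= n < N) u n - csum u) +
            normc (\sum_(0 <= n < N) v n - csum v))); last 2 first.
- exact: cvg_cst.
- by rewrite -(addr0 (0 : R)); apply: cvgD; [exact: cu|exact: cv].
apply: nearW => N; rewrite normc_ge0/= big_split/= opprD addrACA.
exact: normcD.
Qed.

Lemma csumZ z u B : abs_sum_le u B -> csum (fun n => z * u n) = z * csum u.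
Proof.
move=> /csum_cvg cu; apply: csum_unique.
apply: (@squeeze_cvgr _ _ _ _ (fun=> 0)
  (fun N => normc z * normc (\sum_(0 <= n < N) u n - csum u))); last 2 first.
- exact: cvg_cst.
- by rewrite -(mulr0 (normc z)); apply: cvgM => //; exact: cvg_cst.
by apply: nearW => N; rewrite normc_ge0/= -mulr_sumr -mulrBr Normc.normcM.
Qed.

Lemma abs_sum_leD u v B B' : abs_sum_le u B -> abs_sum_le v B' ->
  abs_sum_le (fun n => u n + v n) (B + B').
Proof.
move=> uB vB N; apply: le_trans (lerD (uB N) (vB N)).
by rewrite -big_split/=; apply: ler_sum => n _; exact: normcD.
Qed.

Lemma abs_sum_leZ z u B : abs_sum_le u B ->
  abs_sum_le (fun n => z * u n) (normc z * B).
Proof.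
move=> uB N; under eq_bigr do rewrite Normc.normcM.
by rewrite -mulr_sumr ler_wpM2l ?normc_ge0.
Qed.

Lemma csum_finite u (m : nat) : (forall n, (m <= n)%N -> u n = 0) ->
  csum u = \sum_(0 <= n < m) u n.
Proof.
move=> u0; apply: csum_unique; apply: cvg_near_cst.
exists m => // N /= mN; rewrite (big_cat_nat (leq0n m) mN)//=.
rewrite [X in _ + X - _]big_nat_cond [X in _ + X - _]big1; last first.
  by move=> n /andP[/andP[mn _] _]; exact: u0.
by rewrite addr0 subrr Normc.normc0.
Qed.

End ComplexSeries.

(** * Newton products *)

Section NewtonProducts.
Context {R : realType}.
Implicit Types (w s : R[i]) (r : R) (n j J : nat).

(** The hypothesis says that [(c - 1) * a n.+1] is at most [n.+1 * a n - n.+2 * a n.+1], and these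
    differences telescope. *)
Lemma raabe_summable (a : nat -> R) (c : R) (K : nat) : 1 < c ->
  (forall n, 0 <= a n) ->
  (forall n, (K <= n)%N -> (n.+1%:R + c) * a n.+1 <= n.+1%:R * a n) ->
  exists B, forall N, \sum_(0 <= n < N) a n <= B.
Proof.
move=> c1 a0 ha.
have tel m : (c - 1) * \sum_(0 <= i < m) a (K + i).+1 +
    (K + m).+1%:R * a (K + m)%N <= K.+1%:R * a K.
  elim: m => [|m IHm]; first by rewrite big_geq// mulr0 add0r addn0.
  apply: le_trans IHm; rewrite big_nat_recr//= mulrDr addnS -[leLHS]addrA lerD2l.
  have := ha (K + m)%N (leq_addr _ _).
  rewrite -[(K + m).+2%:R]natr1; nra.
exists (\sum_(0 <= n < K.+1) a n + (c - 1)^-1 * (K.+1%:R * a K)) => N.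
apply: (@le_trans _ _ (\sum_(0 <= n < K.+1 + N) a n)).
  rewrite [leRHS](big_cat_nat (leq0n N) (leq_addl _ _))//= lerDl.
  by apply: sumr_ge0 => n _; exact: a0.
rewrite (big_cat_nat (leq0n K.+1) (leq_addr _ _))//= lerD2l.
rewrite ler_pdivlMl ?subr_gt0//.
rewrite -{1}[K.+1]add0n big_addn addKn.
apply: le_trans (tel N).
under eq_bigr do rewrite addnS addnC.
by rewrite lerDl mulr_ge0.
Qed.

(** Otherwise [l^-1 * |a n|] would eventually dominate the harmonic series. *)
Lemma summable_not_ge_harmonic (a : nat -> R) (l B : R) :
  (forall N, \sum_(0 <= n < N) `|a n| <= B) -> 0 < l ->
  ~ (\forall n \near \oo, l <= n.+1%:R * a n).
Proof.
move=> aB l0 [K _ hK]; apply: (@dvg_harmonic R).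
apply: (@cvg_series_bound _ _ (\sum_(0 <= n < K) harmonic n + l^-1 * B)) => N.
apply: (@le_trans _ _ (\sum_(0 <= n < K + N) harmonic n)).
  rewrite [leRHS](big_cat_nat (leq0n N) (leq_addl _ _))//= -[leLHS]addr0.
  apply: lerD; last by apply: sumr_ge0 => n _; rewrite invr_ge0.
  by apply: ler_sum => n _; rewrite ger0_norm// invr_ge0.
rewrite (big_cat_nat (leq0n K) (leq_addr _ _))//= lerD2l.
rewrite ler_pdivlMl//; apply: le_trans (aB (K + N)%N).
rewrite [leRHS](big_cat_nat (leq0n K) (leq_addr _ _))//= -[leLHS]add0r.
apply: lerD; first by apply: sumr_ge0.
rewrite mulr_sumr; apply: ler_sum_nat => n /andP[Kn _].
rewrite -/(l / n.+1%:R) ler_pdivrMr// mulrC; apply: le_trans (hK n Kn) _.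
by rewrite ler_wpM2l// ler_norm.
Qed.

(** * Growth of the Newton products and of their Taylor coefficients *)

Lemma normc_sqr (z : R[i]) :
  normc z ^+ 2 = complex.Re z ^+ 2 + complex.Im z ^+ 2.
Proof. by case: z => a b /=; rewrite sqr_sqrtr// addr_ge0 ?sqr_ge0. Qed.

Lemma divc_nat w n :
  w / n%:R = Complex (complex.Re w / n%:R) (complex.Im w / n%:R).
Proof.
case: w => a b; rewrite -(rmorph_nat (@real_complex R)) -fmorphV/=.
by simpc.
Qed.

Lemma normc_nat n : normc (n%:R : R[i]) = n%:R.
Proof. by rewrite -(rmorph_nat (@real_complex R)) normc_real normr_nat. Qed.

Lemma Re_1B_div w n : complex.Re (1 - w / n%:R) = 1 - complex.Re w / n%:R.
Proof. by rewrite divc_nat. Qed.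

(** After squaring and multiplying by [x ^+ 2], where [x = k.+1], the right side exceeds the left by
    [2 x (Re w - b) + b^2 - |w|^2], which is nonnegative for large [x]. *)
Lemma normc_1B_le w (b : R) : b < complex.Re w ->
  exists K, forall k, (K <= k)%N ->
    normc (1 - w / k.+1%:R) <= 1 - b / k.+1%:R.
Proof.
move=> bw; have d0 : 0 < complex.Re w - b by rewrite subr_gt0.
(* The first summand gives [b <= k.+1], so that squares can be compared; the second lets the linear
   term absorb [|w|^2]. *)
set M := `|b| + normc w ^+ 2 / (complex.Re w - b).
exists (Num.bound M) => k Kk.
have Mk : M < k.+1%:R.
  apply: lt_le_trans (_ : (Num.bound M)%:R <= _).
    by apply: archi_boundP; rewrite addr_ge0// divr_ge0 ?sqr_ge0// ltW.
  by rewrite ler_nat ltnW.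
have w0 : 0 <= normc w ^+ 2 / (complex.Re w - b).
  by rewrite divr_ge0 ?sqr_ge0// ltW.
have bk : b <= k.+1%:R.
  by apply: le_trans (ler_norm b) _; rewrite (le_trans _ (ltW Mk))// lerDl.
have wk : normc w ^+ 2 <= k.+1%:R * (complex.Re w - b).
  rewrite -ler_pdivrMr//; apply: le_trans (ltW Mk); by rewrite lerDr.
move: wk; rewrite normc_sqr => wk.
rewrite -ler_sqr ?nnegrE ?normc_ge0//; last first.
  by rewrite subr_ge0 ler_pdivrMr// mul1r.
rewrite normc_sqr divc_nat/=.
have x0 : 0 < k.+1%:R :> R by [].
move: (k.+1%:R : R) x0 bk wk {Mk} => x x0 bk wk.
rewrite -(ler_pM2r (exprn_gt0 2 x0)) -subr_ge0.
have -> : (1 - b / x) ^+ 2 * x ^+ 2 -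
    ((1 - complex.Re w / x) ^+ 2 + (0 - complex.Im w / x) ^+ 2) * x ^+ 2 =
    (x - b) ^+ 2 - (x - complex.Re w) ^+ 2 - complex.Im w ^+ 2.
  by field; rewrite gt_eqF.
nra.
Qed.

(** This is [(-1)^n] times the binomial coefficient of [w - 1] over [n], so a series in these
    products is a Newton series. *)
Definition newton_prod w n : R[i] := \prod_(0 <= k < n) (1 - w / k.+1%:R).

(** Bounds [newton_prod (w + s) n] whenever [normc s <= r], and controls its Taylor coefficients at
    [w]; [r = 0] gives the modulus itself. *)
Definition majorant w r n : R :=
  \prod_(0 <= k < n) (normc (1 - w / k.+1%:R) + r / k.+1%:R).

Lemma newton_prodS w n :
  newton_prod w n.+1 = newton_prod w n * (1 - w / n.+1%:R).
Proof. by rewrite /newton_prod big_nat_recr. Qed.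

Lemma majorantS w r n :
  majorant w r n.+1 = majorant w r n * (normc (1 - w / n.+1%:R) + r / n.+1%:R).
Proof. by rewrite /majorant big_nat_recr. Qed.

Lemma majorant_ge0 w r n : 0 <= r -> 0 <= majorant w r n.
Proof.
move=> r0; apply: prodr_ge0 => k _.
by rewrite addr_ge0 ?normc_ge0// divr_ge0.
Qed.

Lemma normc_newton_prod w n : normc (newton_prod w n) = majorant w 0 n.
Proof.
elim: n => [|n IHn]; last first.
  by rewrite newton_prodS majorantS Normc.normcM IHn mul0r addr0.
by rewrite /newton_prod /majorant !big_geq// Normc.normc1.
Qed.

(** Bernoulli's inequality for an exponent below 1, derived from Young's inequality with exponents
    [s^-1] and [(1 - s)^-1]. *)
Lemma powR_le_1B (s : R) n : 0 < s -> s < 1 ->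
  (n%:R / n.+1%:R) `^ s <= 1 - s / n.+1%:R.
Proof.
move=> s0 s1; have x0 : 0 <= n%:R / n.+1%:R :> R by rewrite divr_ge0.
have := @conjugate_powR R ((n%:R / n.+1%:R) `^ s) 1 s^-1 (1 - s)^-1
  (powR_ge0 _ _) ler01.
rewrite !invr_gt0 subr_gt0 !invrK => /(_ s0 s1).
rewrite -powRrM mulfV ?gt_eqF// powRr1// powR1 mulr1 mul1r => h.
apply: le_trans (h _) _; first by rewrite addrC subrK.
rewrite le_eqVlt; apply/orP; left; apply/eqP; rewrite -natr1.
by field; rewrite natr1 pnatr_eq0.
Qed.

(** Each factor has modulus at least [1 - s / k.+1]. The first one gives the constant [1 - s]; the
    others are bounded below by [powR_le_1B], and those bounds telescope. *)
Lemma newton_prod_lower mu (s : R) n : 0 < s -> s < 1 -> complex.Re mu <= s ->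
  (1 - s) * n.+1%:R `^ (- s) <= normc (newton_prod mu n.+1).
Proof.
move=> s0 s1 mus.
have fac k : 1 - s / k.+1%:R <= normc (1 - mu / k.+1%:R).
  apply: le_trans (Re_le_normc _); apply: le_trans (ler_norm _).
  by rewrite Re_1B_div lerD2l lerN2 ler_wpM2r ?invr_ge0.
elim: n => [|n IHn].
  rewrite powR1 mulr1 newton_prodS [newton_prod _ 0]big_geq// mul1r.
  by have := fac 0; rewrite divr1.
rewrite newton_prodS Normc.normcM.
have -> : (n.+2%:R `^ (- s) : R) =
    n.+1%:R `^ (- s) * (n.+1%:R / n.+2%:R) `^ s.
  rewrite powRM ?invr_ge0// !powRN mulrA mulVf ?mul1r; last first.
    by rewrite gt_eqF// powR_gt0.
  by rewrite -[in RHS]powR_inv1// -powRrM mulN1r powRN.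
rewrite mulrA; apply: ler_pM.
- by rewrite mulr_ge0 ?powR_ge0// subr_ge0 ltW.
- exact: powR_ge0.
- exact: IHn.
- exact: le_trans (powR_le_1B _ s0 s1) (fac _).
Qed.

(* The tail bound behind Hölder's inequality: [majorant w r n] decays like
   [n `^ (r - complex.Re w)], so its [q]-th power passes Raabe's test. *)
Lemma majorant_summable w r (kappa : R) : 0 < kappa -> 0 <= r ->
  kappa < complex.Re w - r ->
  exists B, forall N, \sum_(0 <= n < N) majorant w r n `^ kappa^-1 <= B.
Proof.
move=> k0 r0 kw.
(* The midpoint of [kappa] and [Re w - r]: it leaves room for [normc_1B_le] at [a + r] and makes the
   Raabe exponent [a / kappa] exceed 1. *)
pose a := (complex.Re w - r + kappa) / 2.
have [ka aw] : kappa < a /\ a + r < complex.Re w.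
  by rewrite {}/a; move: (complex.Re w) kw => x kw; split; lra.
have [K hK] := normc_1B_le aw.
apply: (@raabe_summable _ (a / kappa) K).
- by rewrite ltr_pdivlMr// mul1r.
- by move=> n; exact: powR_ge0.
move=> n Kn; rewrite majorantS powRM ?majorant_ge0 ?addr_ge0 ?normc_ge0 ?divr_ge0//.
rewrite mulrCA [leRHS]mulrC ler_wpM2l ?powR_ge0//.
set u := normc _ + _.
have u0 : 0 <= u by rewrite addr_ge0 ?normc_ge0 ?divr_ge0.
have ue : u <= expR (- (a / n.+1%:R)).
  apply: le_trans (expR_ge1Dx _); rewrite /u.
  have := hK n Kn; rewrite mulrDl.
  by move: (normc _) (a / _) (r / _) => x y z; lra.
have c0 : 0 < a / kappa by rewrite divr_gt0// (lt_trans k0).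
have uq : u `^ kappa^-1 <= expR (- (a / kappa / n.+1%:R)).
  apply: (@le_trans _ _ (expR (- (a / n.+1%:R)) `^ kappa^-1)).
    by apply: ge0_ler_powR; rewrite ?nnegrE ?expR_ge0 ?invr_ge0 ?(ltW k0).
  by rewrite -expRM mulNr mulrAC.
apply: (@le_trans _ _ ((n.+1%:R + a / kappa) * expR (- (a / kappa / n.+1%:R)))).
  by rewrite ler_wpM2l// addr_ge0// ltW.
rewrite expRN ler_pdivrMr ?expR_gt0//.
have := expR_ge1Dx (a / kappa / n.+1%:R).
have n0 : 0 < n.+1%:R :> R by [].
move=> /(ler_wpM2l (ltW n0)); rewrite mulrDr mulr1.
by rewrite mulrCA divff ?gt_eqF// mulr1.
Qed.

(** Coefficient of [s ^+ j] in [newton_prod (w + s) n], obtained by multiplying by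
    [(1 - w / m.+1) - s / m.+1] at each stage. *)
Fixpoint newton_coef w n : nat -> R[i] :=
  if n is m.+1 then
    fun j => newton_coef w m j * (1 - w / m.+1%:R) -
             (if j is i.+1 then newton_coef w m i / m.+1%:R else 0)
  else fun j => (j == 0)%:R.

(** Cauchy's estimate on the disc of radius [r], obtained algebraically: the recursion for the
    coefficients is dominated by that of the majorant. *)
Lemma normc_newton_coef w r n j : 0 <= r ->
  normc (newton_coef w n j) * r ^+ j <= majorant w r n.
Proof.
move=> r0; elim: n j => [|n IHn] j.
  rewrite /majorant big_geq// /newton_coef; case: j => [|j].
    by rewrite Normc.normc1 expr0 mulr1.
  by rewrite Normc.normc0 mul0r.
rewrite majorantS mulrDr /=.
apply: (@le_trans _ _ (normc (newton_coef w n j * (1 - w / n.+1%:R)) * r ^+ j +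
  normc (if j is i.+1 then newton_coef w n i / n.+1%:R else 0) * r ^+ j)).
  rewrite -mulrDl ler_wpM2r ?exprn_ge0//; apply: le_trans (normcD _ _) _.
  by rewrite normcN.
apply: lerD.
  by rewrite Normc.normcM mulrAC ler_wpM2r ?normc_ge0.
case: j => [|j].
  by rewrite Normc.normc0 mul0r mulr_ge0 ?majorant_ge0 ?divr_ge0.
rewrite Normc.normcM Normc.normcV normc_nat exprS.
have -> : normc (newton_coef w n j) / n.+1%:R * (r * r ^+ j) =
  normc (newton_coef w n j) * r ^+ j * (r / n.+1%:R) by ring.
by rewrite ler_wpM2r ?divr_ge0.
Qed.

(** Induction on [n]: the new remainder of order [J] is [1 - w / n.+1] times the old one minus
    [s / n.+1] times the old remainder of order [J.-1]. The factor [s] restores the lost power of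
    [normc s / r] and leaves the [r / n.+1] of the majorant. *)
Lemma newton_prod_taylor w s r n J : 0 < r -> normc s <= r ->
  normc (newton_prod (w + s) n - \sum_(0 <= j < J) newton_coef w n j * s ^+ j)
  <= (normc s / r) ^+ J * majorant w r n.
Proof.
move=> r0 sr; elim: n J => [|n IHn] J.
  rewrite [newton_prod _ _]big_geq// [majorant _ _ _]big_geq// mulr1.
  case: J => [|J]; first by rewrite big_geq// subr0 Normc.normc1 expr0.
  rewrite big_nat_recl//= mul1r expr0 big1 => [|i _]; last by rewrite mul0r.
  by rewrite addr0 subrr Normc.normc0 exprn_ge0// divr_ge0 ?normc_ge0 ?ltW.
set rem := fun J => newton_prod (w + s) n -
  \sum_(0 <= j < J) newton_coef w n j * s ^+ j.
have remS : newton_prod (w + s) n.+1 -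
    \sum_(0 <= j < J) newton_coef w n.+1 j * s ^+ j =
    rem J * (1 - w / n.+1%:R) - s / n.+1%:R * rem J.-1.
  rewrite /rem newton_prodS; case: J => [|J].
    by rewrite !big_geq//; ring.
  under eq_bigr do rewrite /= mulrBl.
  rewrite sumrB/=.
  rewrite [X in _ - (_ - X) = _]big_nat_recl//= mul0r add0r.
  rewrite [X in _ - (X - _) = _](_ : _ = (1 - w / n.+1%:R) *
      \sum_(0 <= j < J.+1) newton_coef w n j * s ^+ j); last first.
    by rewrite mulr_sumr; apply: eq_bigr => j _; ring.
  rewrite [X in _ - (_ - X) = _](_ : _ = s / n.+1%:R *
      \sum_(0 <= j < J) newton_coef w n j * s ^+ j); last first.
    by rewrite mulr_sumr; apply: eq_bigr => j _; rewrite exprS; ring.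
  by ring.
rewrite remS; apply: le_trans (normcD _ _) _.
rewrite normcN !Normc.normcM Normc.normcV normc_nat majorantS mulrDr mulrDr.
apply: lerD; first by rewrite mulrA ler_wpM2r ?normc_ge0 ?IHn.
apply: (@le_trans _ _ (normc s / n.+1%:R *
    ((normc s / r) ^+ J.-1 * majorant w r n))).
  by rewrite ler_wpM2l ?divr_ge0 ?normc_ge0 ?IHn.
have m0 : 0 <= majorant w r n by rewrite majorant_ge0// ltW.
(* For [J = 0] the predecessor is again [0], and [normc s <= r] takes the place of the missing
   power. *)
case: J {rem remS} => [|J] /=.
  rewrite expr0 !mul1r mulrC ler_wpM2l// ler_wpM2r//.
rewrite exprS le_eqVlt; apply/orP; left; apply/eqP.
by field; rewrite [1 + _]addrC natr1 pnatr_eq0 (gt_eqF r0).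
Qed.

(** Termwise [newton_prod_taylor], summed against [y]. This quantitative expansion is the form in
    which analyticity in [w] is used below. *)
Lemma newton_series_taylor (y : nat -> R[i]) w r B : 0 < r ->
  (forall N, \sum_(0 <= n < N) normc (y n) * majorant w r n <= B) ->
  forall s J, normc s <= r ->
  normc (csum (fun n => y n * newton_prod (w + s) n) -
         \sum_(0 <= j < J) csum (fun n => y n * newton_coef w n j) * s ^+ j)
  <= (normc s / r) ^+ J * B.
Proof.
move=> r0 yB s J sr.
have coefB j : abs_sum_le (fun n => y n * newton_coef w n j) (B / r ^+ j).
  move=> N; rewrite ler_pdivlMr ?exprn_gt0// mulr_suml; apply: le_trans (yB N).
  apply: ler_sum => n _; rewrite Normc.normcM -mulrA.
  by rewrite ler_wpM2l ?normc_ge0// normc_newton_coef// ltW.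
have [B' polyB polyE] : exists2 B',
    abs_sum_le (fun n => y n * \sum_(0 <= j < J) newton_coef w n j * s ^+ j) B' &
    csum (fun n => y n * \sum_(0 <= j < J) newton_coef w n j * s ^+ j) =
    \sum_(0 <= j < J) csum (fun n => y n * newton_coef w n j) * s ^+ j.
  elim: J => [|J [B' IB IE]].
    exists 0; last first.
      by rewrite big_geq// (@csum_finite _ _ 0) ?big_geq// => n _; rewrite big_geq ?mulr0.
    move=> N; rewrite big1// => n _; by rewrite big_geq// mulr0 Normc.normc0.
  have fE : (fun n => y n * \sum_(0 <= j < J.+1) newton_coef w n j * s ^+ j) =
    (fun n => y n * (\sum_(0 <= j < J) newton_coef w n j * s ^+ j) +
              s ^+ J * (y n * newton_coef w n J)).
    by apply/funext => n; rewrite big_nat_recr//=; ring.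
  exists (B' + normc (s ^+ J) * (B / r ^+ J)); rewrite fE.
    by apply: abs_sum_leD => //; exact: abs_sum_leZ.
  rewrite (csumD IB (abs_sum_leZ _ (coefB J))) (csumZ _ (coefB J)) IE.
  by rewrite big_nat_recr//= [s ^+ J * _]mulrC.
have prodB : abs_sum_le (fun n => y n * newton_prod (w + s) n) B.
  move=> N; apply: le_trans (yB N); apply: ler_sum => n _.
  rewrite Normc.normcM ler_wpM2l ?normc_ge0//.
  have := newton_prod_taylor w n 0 r0 sr.
  by rewrite big_geq// subr0 expr0 mul1r.
rewrite -polyE -[X in _ + X]mulN1r -(csumZ _ polyB).
rewrite -(csumD prodB (abs_sum_leZ _ polyB)).
apply: normc_csum_le => N.
apply: le_trans (ler_wpM2l _ (yB N)); last first.
  by rewrite exprn_ge0// divr_ge0 ?normc_ge0 ?ltW.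
rewrite mulr_sumr; apply: ler_sum => n _.
rewrite mulN1r -mulrBr Normc.normcM mulrCA ler_wpM2l ?normc_ge0//.
exact: newton_prod_taylor.
Qed.

End NewtonProducts.

(** * Identity theorem on a half-plane *)

Section IdentityTheorem.
Context {R : realType}.
Implicit Types (w s v : R[i]) (r e : R).

(** If the coefficients below [j] vanish, a small [t] with [f t = 0] gives [|A j| <= t B / r^(j+1)],
    so [A j] vanishes too. Then [f s] is bounded by a geometric sequence tending to 0. *)
Lemma power_expansion_vanish (f : R[i] -> R[i]) (A : nat -> R[i]) r B e :
  0 < r -> 0 < e ->
  (forall s J, normc s <= r ->
    normc (f s - \sum_(0 <= j < J) A j * s ^+ j) <= (normc s / r) ^+ J * B) ->
  (forall s, normc s < e -> f s = 0) ->
  forall s, normc s < r -> f s = 0.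
Proof.
move=> r0 e0 fA f0.
have A0 j : A j = 0.
  elim/ltn_ind: j => j IHj; apply: Normc.eq0_normc; apply/eqP.
  rewrite eq_le normc_ge0 andbT; apply/ler_addgt0Pr => d d0; rewrite add0r.
  have B0 : 0 <= B.
    have := fA 0 0; rewrite expr0 mul1r Normc.normc0 => /(_ (ltW r0)).
    exact: le_trans (normc_ge0 _).
  (* Below [e] so that [f] vanishes, at most [r] so that the expansion applies, and so small that
     [t * B / r ^+ j.+1 <= d]; [B + 1] keeps the denominator positive. *)
  pose t := Num.min (e / 2) (Num.min r (d * r ^+ j.+1 / (B + 1))).
  have t0 : 0 < t.
    rewrite /t !lt_min r0 divr_gt0//= divr_gt0//; last by rewrite ltr_wpDl.
    by rewrite mulr_gt0// exprn_gt0.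
  have [te tr tB] : [/\ t < e, t <= r & t * (B + 1) <= d * r ^+ j.+1].
    split; first by rewrite (@le_lt_trans _ _ (e / 2))// ?ge_min ?lexx//; lra.
      by rewrite !ge_min lexx orbT.
    by rewrite -ler_pdivlMr ?ltr_wpDl// !ge_min lexx !orbT.
  have tn : normc t%:C%C = t by rewrite normc_real gtr0_norm.
  have := fA t%:C%C j.+1; rewrite tn f0 ?tn// => /(_ tr).
  rewrite big_nat_recr//= big_nat_cond big1 => [|i /andP[/andP[_ ij] _]]; last first.
    by rewrite IHj// mul0r.
  rewrite !add0r normcN Normc.normcM normcX tn expr_div_n exprS.
  move=> h; have tj : 0 < t ^+ j by rewrite exprn_gt0.
  have rj : 0 < r ^+ j.+1 by rewrite exprn_gt0.
  rewrite -(ler_pM2r tj); apply: le_trans h _.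
  have -> : t * t ^+ j / r ^+ j.+1 * B = t * B / r ^+ j.+1 * t ^+ j by ring.
  rewrite ler_pM2r// ler_pdivrMr//; apply: le_trans tB.
  by rewrite ler_pM2l// lerDl.
move=> s sr; apply: Normc.eq0_normc; apply/eqP.
rewrite eq_le normc_ge0 andbT.
have geo : (fun J => (normc s / r) ^+ J * B) @ \oo --> (0 : R).
  rewrite -(mul0r B); apply: cvgMl; apply: cvg_expr.
  by rewrite ger0_norm ?divr_ge0 ?normc_ge0 ?ltW// ltr_pdivrMr// mul1r.
rewrite -(cvg_lim _ geo)//; apply: limr_ge; first by apply/cvg_ex; exists 0.
apply: nearW => J; have := fA s J (ltW sr).
by rewrite big1 ?subr0// => j _; rewrite A0 mul0r.
Qed.

(** Continuation along a chain of discs centred on the segment from [w] to [v]. *)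
Lemma half_plane_propagation (f : R[i] -> R[i]) (c : R) :
  (forall w r e, 0 < r -> r < complex.Re w - c -> 0 < e ->
    (forall s, normc s < e -> f (w + s) = 0) ->
    forall s, normc s < r -> f (w + s) = 0) ->
  forall w e v, c < complex.Re w -> 0 < e ->
  (forall s, normc s < e -> f (w + s) = 0) ->
  c < complex.Re v -> f v = 0.
Proof.
move=> hf w e v cw e0 fw cv.
(* By convexity every point of the segment is at distance at least [d] from the boundary line, so
   discs of radius [d / 2] are admissible; steps shorter than [d / 2] put each centre in the
   previous disc. *)
pose d := Num.min (complex.Re w) (complex.Re v) - c.
have d0 : 0 < d by rewrite subr_gt0 lt_min cw.
pose N := (Num.bound (normc (v - w) / (d / 2))).+1.
pose t := (v - w) / N%:R.
have N0 : 0 < N%:R :> R by [].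
have tN : normc t < d / 2.
  rewrite Normc.normcM Normc.normcV normc_nat ltr_pdivrMr// mulrC.
  rewrite -ltr_pdivrMr ?divr_gt0//.
  apply: (@lt_le_trans _ _ (Num.bound (normc (v - w) / (d / 2)))%:R); last first.
    by rewrite ler_nat.
  by apply: archi_boundP; rewrite divr_ge0 ?normc_ge0// divr_ge0// ltW.
have Re_step k : (k <= N)%N -> d + c <= complex.Re (w + k%:R * t).
  move=> kN; rewrite /d subrK /t mulrCA mulrC.
  have -> : complex.Re (w + k%:R / N%:R * (v - w)) =
     complex.Re w + k%:R / N%:R * (complex.Re v - complex.Re w).
    rewrite -(rmorph_nat (@real_complex R) k) -(rmorph_nat (@real_complex R) N).
    rewrite -fmorphV/= -rmorphM/=; case: (v) => a b; case: (w) => a' b' /=; simpc.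
    by [].
  have x0 : 0 <= k%:R / N%:R :> R by rewrite divr_ge0.
  have x1 : k%:R / N%:R <= 1 :> R by rewrite ler_pdivrMr// mul1r ler_nat.
  move: (_ / _) x0 x1 => x x0 x1.
  case: (leP (complex.Re w) (complex.Re v)) => h.
    by rewrite lerDl mulr_ge0 ?subr_ge0.
  have : 0 <= (1 - x) * (complex.Re w - complex.Re v).
    by rewrite mulr_ge0 ?subr_ge0// ltW.
  by move: (complex.Re w) (complex.Re v) => a b; lra.
have step k : (k <= N)%N ->
    exists2 e', 0 < e' & forall s, normc s < e' -> f (w + k%:R * t + s) = 0.
  elim: k => [_|k IHk kN]; first by exists e; rewrite // mul0r addr0.
  have [e' e'0 fe'] := IHk (ltnW kN).
  exists (d / 2 - normc t); first by rewrite subr_gt0.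
  move=> s; rewrite ltrBrDl => st.
  have -> : w + k.+1%:R * t + s = w + k%:R * t + (t + s) by rewrite -natr1; ring.
  apply: (hf _ (d / 2) e') => //; first by rewrite divr_gt0.
    by have := Re_step k (ltnW kN); lra.
  exact: le_lt_trans (normcD _ _) st.
have [e' e'0] := step N (leqnn N); move/(_ 0); rewrite Normc.normc0 => /(_ e'0).
rewrite addr0 /t mulrCA divff ?mulr1; last by rewrite pnatr_eq0.
by rewrite addrC subrK.
Qed.

End IdentityTheorem.

(** * Coordinates in l^p *)

Section LpCoordinates.
Context {R : realType} {p : R} (p1 : 1 < p).
Implicit Types (f g : lp p1) (N : nat).

Let p_gt0 : 0 < p. Proof. exact: lt_trans p1. Qed.

Lemma lpnorm_bound (f : nat -> R[i]) (K : R) : 0 <= K ->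
  (forall N, \sum_(0 <= n < N) normc (f n) `^ p <= K) ->
  (lpnorm p f <= (K `^ p^-1)%:E)%E.
Proof.
move=> K0 fK; rewrite lpnormE// -poweR_EFin; apply: gt0_ler_poweR.
- by rewrite invr_ge0 ltW.
- rewrite in_itv/= leey andbT; apply: nneseries_ge0 => k _ _.
  by rewrite lee_fin powR_ge0.
- by rewrite in_itv/= leey andbT lee_fin.
apply: lime_le; first by apply: is_cvg_nneseries => k _ _; rewrite lee_fin powR_ge0.
by apply: nearW => N; rewrite sumEFin lee_fin.
Qed.

Lemma lp_norm_le f (K : R) : 0 <= K ->
  (forall N, \sum_(0 <= n < N) normc (f n) `^ p <= K) ->
  `|f| <= (K `^ p^-1)%:C%C.
Proof.
move=> K0 fK; rewrite lp_normE lecR -lee_fin fineK ?lpnorm_fin_num//.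
exact: lpnorm_bound.
Qed.

Lemma lp_sum_le f (C : R) : `|f| <= C%:C%C ->
  forall N, \sum_(0 <= n < N) normc (f n) `^ p <= C `^ p.
Proof.
rewrite lp_normE lecR => fC N.
have pos k : (0 <= (normc (f k) `^ p)%:E)%E by rewrite lee_fin powR_ge0.
have : (lpnorm p f <= C%:E)%E by rewrite -[leLHS]fineK ?lpnorm_fin_num.
have C0 : 0 <= C by rewrite (le_trans _ fC)// fine_ge0// lpnorm_ge0.
move=> /(gt0_ler_poweR (ltW p_gt0)).
rewrite !in_itv/= !leey !andbT lpnorm_ge0 lee_fin => /(_ isT C0).
rewrite lpnormE// -poweRrM mulVf ?gt_eqF// poweRe1; last first.
  exact: nneseries_ge0.
rewrite -lee_fin => /(le_trans _); apply; rewrite -sumEFin.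
exact: nneseries_lim_ge.
Qed.

Lemma lp_coordD f g n : (f + g) n = f n + g n. Proof. by []. Qed.

Lemma lp_coordZ (z : R[i]) f n : (z *: f) n = z * f n. Proof. by []. Qed.

Lemma lp_coord_sum (F : nat -> lp p1) N n :
  (\sum_(0 <= i < N) F i) n = \sum_(0 <= i < N) F i n.
Proof.
elim: N => [|N IHN]; first by rewrite !big_geq.
by rewrite [in LHS]big_nat_recr// [in RHS]big_nat_recr// -IHN.
Qed.

Fact delta_in_lp (j : nat) : (fun n => (n == j)%:R : R[i]) \in in_lp p1.
Proof.
rewrite in_lpE; apply: le_lt_trans (ltry (1 `^ p^-1)).
apply: lpnorm_bound => // N.
have h n : normc ((n == j)%:R : R[i]) `^ p = (n == j)%:R.
  case: eqP => _; first by rewrite Normc.normc1 powR1.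
  by rewrite Normc.normc0 powR0// gt_eqF.
under eq_bigr do rewrite h.
elim: N => [|N IHN]; first by rewrite big_geq.
have [jN|Nj] := ltnP j N.
  by rewrite big_nat_recr//= (gtn_eqF jN) addr0.
rewrite big_nat_recr//= big_nat big1 ?add0r; first by case: eqP.
by move=> i iN; rewrite ltn_eqF// (leq_trans iN).
Qed.

Definition lp_delta j : lp p1 := Lp (delta_in_lp j).

Lemma lp_delta_sum (a : nat -> R[i]) N n :
  (\sum_(0 <= j < N) a j *: lp_delta j) n = if (n < N)%N then a n else 0.
Proof.
rewrite lp_coord_sum; elim: N => [|N IHN]; first by rewrite big_geq.
rewrite big_nat_recr// IHN lp_coordZ (_ : lp_delta N n = (n == N)%:R)// ltnS.
by case: (ltngtP n N) => [||->] /=; rewrite ?mulr0 ?addr0 ?mulr1 ?add0r.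
Qed.

(** Density of finite sequences: a bounded operator is determined by its values on the
    [lp_delta j]. *)
Lemma lp_truncation_cvg f (e : R) : 0 < e ->
  exists N, `|f - \sum_(0 <= j < N) f j *: lp_delta j| <= e%:C%C.
Proof.
move=> e0.
have pos k : (0 <= (normc (f k) `^ p)%:E)%E by rewrite lee_fin powR_ge0.
have ep : 0 < e `^ p by rewrite powR_gt0.
have : cvgn (series (fun n => normc (f n) `^ p)).
  apply: (@cvg_series_bound _ _ (fine (lpnorm p f) `^ p)) => N.
  by under eq_bigr do rewrite ger0_norm ?powR_ge0//; exact: lp_sum_le.
set u := series _ => cu.
have /cvgr_dist_lt : u @ \oo --> limn u by [].
have u_nd : nondecreasing_seq u.
  by apply: nondecreasing_series => n _ _; exact: powR_ge0.
move=> /(_ _ ep)[N _ hN]; exists N.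
have -> : e = (e `^ p) `^ p^-1 by rewrite -powRrM mulfV ?gt_eqF// powRr1// ltW.
apply: lp_norm_le => [|m]; first exact: ltW.
have coord n : (f - \sum_(0 <= j < N) f j *: lp_delta j) n =
    if (n < N)%N then 0 else f n.
  rewrite -scaleN1r lp_coordD lp_coordZ lp_delta_sum.
  by case: ifP => _; rewrite ?mulN1r ?subrr// oppr0 addr0.
move: (f - _) coord => g coord.
apply: (@le_trans _ _ (limn u - u N)); last first.
  have := hN N (leqnn N) => /= /ltW; exact: le_trans (ler_norm _).
rewrite lerBrDr.
apply: (@le_trans _ _ (u (m + N)%N)); last exact: nondecreasing_cvgn_le.
rewrite /u /series/= [leRHS](big_cat_nat (leq0n N) (leq_addl _ _))//= [leLHS]addrC lerD2l.
apply: (@le_trans _ _ (\sum_(0 <= n < m + N) normc (g n) `^ p)).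
  rewrite [leRHS](big_cat_nat (leq0n m) (leq_addr _ _))//= lerDl.
  by apply: sumr_ge0 => n _; exact: powR_ge0.
rewrite (big_cat_nat (leq0n N) (leq_addl _ _))//= big_nat big1 ?add0r.
  by rewrite big_nat [leRHS]big_nat; apply: ler_sum => n /andP[Nn _];
    rewrite coord ltnNge Nn.
move=> n nN; rewrite coord; move/andP: nN => [_ ->].
by rewrite Normc.normc0 powR0// gt_eqF.
Qed.

(** Young's inequality, term by term, with [p] and its conjugate exponent. The bound is cruder than
    Hölder's but depends on [f] only through [C], hence is uniform on balls. *)
Lemma pairing_bound f (C : R) (U : nat -> R) B : `|f| <= C%:C%C ->
  (forall n, 0 <= U n) ->
  (forall N, \sum_(0 <= n < N) U n `^ (1 - p^-1)^-1 <= B) ->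
  forall N, \sum_(0 <= n < N) normc (f n) * U n <= C `^ p / p + B * (1 - p^-1).
Proof.
move=> fC U0 UB N.
have k0 : 0 < 1 - p^-1 by rewrite subr_gt0 invf_lt1.
have i0 : 0 <= p^-1 by rewrite invr_ge0 ltW.
apply: le_trans (lerD (ler_wpM2r i0 (lp_sum_le fC N))
                      (ler_wpM2r (ltW k0) (UB N))).
rewrite !mulr_suml -big_split/=; apply: ler_sum => n _.
have := @conjugate_powR R (normc (f n)) (U n) p (1 - p^-1)^-1
  (normc_ge0 _) (U0 n) p_gt0.
rewrite invr_gt0 invrK => /(_ k0); apply.
by rewrite addrC subrK.
Qed.

End LpCoordinates.

(** * Pairing l^p with Newton products *)

Section NewtonPairing.
Context {R : realType} {p : R} (p1 : 1 < p).
Local Notation lp := (lp p1).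
Local Notation kappa := (1 - p^-1).
Implicit Types (f y : lp) (w mu : R[i]).

Let p_gt0 : 0 < p. Proof. exact: lt_trans p1. Qed.

Let kappa_gt0 : 0 < kappa. Proof. by rewrite subr_gt0 invf_lt1. Qed.

Let kappa_lt1 : kappa < 1. Proof. by rewrite ltrBlDr ltrDl invr_gt0. Qed.

Definition newton_pairing y w : R[i] := csum (fun n => y n * newton_prod w n).

(** [B] is chosen before [y]: this uniformity on balls is what bounds the functional in
    [pairing_bounded]. *)
Lemma lp_majorant_summable w r : 0 <= r -> kappa < complex.Re w - r ->
  forall C, exists B, forall y, `|y| <= C%:C%C ->
  forall N, \sum_(0 <= n < N) normc (y n) * majorant w r n <= B.
Proof.
move=> r0 wr C; have [B hB] := majorant_summable kappa_gt0 r0 wr.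
exists (C `^ p / p + B * kappa) => y yC.
by apply: pairing_bound => // n; exact: majorant_ge0.
Qed.

Lemma newton_pairing_abs_bound w C : kappa < complex.Re w ->
  exists B, forall y, `|y| <= C%:C%C ->
  abs_sum_le (fun n => y n * newton_prod w n) B.
Proof.
move=> kw; have [|B hB] := lp_majorant_summable (w := w) (lexx 0) _ C.
  by rewrite subr0.
exists B => y yC N; apply: le_trans (hB y yC N).
by apply: ler_sum => n _; rewrite Normc.normcM normc_newton_prod.
Qed.

Lemma newton_pairing_abs w y : kappa < complex.Re w ->
  exists B, abs_sum_le (fun n => y n * newton_prod w n) B.
Proof.
move=> kw.
have [B hB] := newton_pairing_abs_bound (fine (lpnorm p y)) kw.
by exists B; exact: hB.
Qed.

Lemma newton_pairingD w f y : kappa < complex.Re w ->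
  newton_pairing (f + y) w = newton_pairing f w + newton_pairing y w.
Proof.
move=> kw; have [B hf] := newton_pairing_abs f kw.
have [B' hy] := newton_pairing_abs y kw.
rewrite /newton_pairing -(csumD hf hy); congr csum; apply/funext => n.
by rewrite lp_coordD mulrDl.
Qed.

Lemma newton_pairingZ w (z : R[i]) y : kappa < complex.Re w ->
  newton_pairing (z *: y) w = z * newton_pairing y w.
Proof.
move=> kw; have [B hy] := newton_pairing_abs y kw.
rewrite /newton_pairing -(csumZ _ hy); congr csum; apply/funext => n.
by rewrite lp_coordZ mulrA.
Qed.

(** Rests on [newton_prod w n - newton_prod w n.+1 = w / n.+1 * newton_prod w n], the eigenvector
    equation in difference form. *)
Lemma cesaro_newton_parts (y : nat -> R[i]) w N :
  \sum_(0 <= n < N) y n * newton_prod w n =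
  (\sum_(0 <= k < N) y k) * newton_prod w N +
  w * \sum_(0 <= n < N) cesaro_seq y n * newton_prod w n.
Proof.
elim: N => [|N IHN]; first by rewrite !big_geq// mul0r mulr0 addr0.
have sumS (u : nat -> R[i]) :
    \sum_(0 <= n < N.+1) u n = \sum_(0 <= n < N) u n + u N.
  by rewrite big_nat_recr.
have -> : cesaro_seq y = fun n => (\sum_(0 <= k < n.+1) y k) / n.+1%:R by [].
rewrite !sumS IHN newton_prodS.
by field; rewrite addrC natr1 pnatr_eq0.
Qed.

(* Summation by parts. The boundary term converges, and its limit must vanish
   since the boundary term is [n] times the term of a summable series. *)
Lemma newton_pairing_cesaro y w : kappa < complex.Re w ->
  w * newton_pairing (cesaro_op p1 y) w = newton_pairing y w.
Proof.
move=> kw; have [B hy] := newton_pairing_abs y kw.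
have [B' hz] := newton_pairing_abs (cesaro_op p1 y) kw.
pose l := newton_pairing y w - w * newton_pairing (cesaro_op p1 y) w.
suff l0 : l = 0 by apply/eqP; rewrite eq_sym -subr_eq0; apply/eqP.
pose b N := (\sum_(0 <= k < N) y k) * newton_prod w N.
have bl : (fun N => normc (b N - l)) @ \oo --> (0 : R).
  pose dy N := normc (\sum_(0 <= n < N) y n * newton_prod w n -
                      newton_pairing y w).
  pose dz N := normc (\sum_(0 <= n < N) cesaro_op p1 y n * newton_prod w n -
                      newton_pairing (cesaro_op p1 y) w).
  apply: (@squeeze_cvgr _ _ _ _ (fun=> 0)
    (fun N => dy N + normc w * dz N)); last 2 first.
  - exact: cvg_cst.
  - rewrite -(addr0 (0 : R)) -{2}(mulr0 (normc w)).
    apply: cvgD; first exact: csum_cvg hy.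
    by apply: cvgM; [exact: cvg_cst|exact: csum_cvg hz].
  apply: nearW => N; rewrite normc_ge0/=.
  have -> : b N - l = (\sum_(0 <= n < N) y n * newton_prod w n -
      newton_pairing y w) + - (w * (\sum_(0 <= n < N) cesaro_op p1 y n *
      newton_prod w n - newton_pairing (cesaro_op p1 y) w)).
    by rewrite (cesaro_newton_parts y) /l /b; ring.
  by apply: le_trans (normcD _ _) _; rewrite normcN Normc.normcM.
apply: Normc.eq0_normc; apply/eqP; rewrite eq_le normc_ge0 andbT leNgt.
apply/negP => l0.
(* The boundary term [b n.+1] is [n.+1] times the [n]-th term of the Cesàro series times
   [1 - w / n.+1], and the last factor has modulus at most [1 + normc w]. *)
pose a n := (1 + normc w) * normc (cesaro_op p1 y n * newton_prod w n).
have w1 : 0 <= 1 + normc w by rewrite addr_ge0 ?normc_ge0.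
have a0 n : 0 <= a n by rewrite mulr_ge0 ?normc_ge0.
apply: (@summable_not_ge_harmonic _ a (normc l / 2) ((1 + normc w) * B')).
- move=> N; under eq_bigr do rewrite ger0_norm//.
  by rewrite -mulr_sumr ler_wpM2l.
- by rewrite divr_gt0.
have l2 : 0 < normc l / 2 by rewrite divr_gt0.
have [K _ hK] : \forall N \near \oo, `|0 - normc (b N - l)| < normc l / 2.
  by move/cvgr_dist_lt: bl => /(_ _ l2).
exists K => // n /= Kn; have := hK n.+1 (leqW Kn) => /=.
rewrite sub0r normrN ger0_norm ?normc_ge0// => bn.
have lb : normc l / 2 <= normc (b n.+1).
  have := normcD (- (b n.+1 - l)) (b n.+1); rewrite normcN opprB subrK.
  by move: (normc l) (normc (b _)) (normc (b _ - _)) bn => x u v; lra.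
apply: le_trans lb _; rewrite /b newton_prodS.
have -> : (\sum_(0 <= k < n.+1) y k) * (newton_prod w n * (1 - w / n.+1%:R)) =
    n.+1%:R * (cesaro_op p1 y n * newton_prod w n) * (1 - w / n.+1%:R).
  by rewrite cesaro_opE; field; rewrite addrC natr1 pnatr_eq0.
rewrite 2!Normc.normcM normc_nat /a -mulrA ler_wpM2l// mulrC.
rewrite ler_wpM2r ?normc_ge0//; apply: le_trans (normcD _ _) _.
rewrite Normc.normc1 lerD2l normcN Normc.normcM Normc.normcV normc_nat.
by rewrite ler_pdivrMr// ler_peMr ?normc_ge0// ler1n.
Qed.

Lemma newton_pairing_taylor y w r : 0 < r -> kappa < complex.Re w - r ->
  exists A B, forall s J, normc s <= r ->
  normc (newton_pairing y (w + s) - \sum_(0 <= j < J) A j * s ^+ j) <=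
  (normc s / r) ^+ J * B.
Proof.
move=> r0 wr.
have [B hB] := lp_majorant_summable (ltW r0) wr (fine (lpnorm p y)).
exists (fun j => csum (fun n => y n * newton_coef w n j)), B.
apply: newton_series_taylor => //; exact: hB.
Qed.

(** The factor with [k = m] is zero, and it occurs in every product with [n > m]. *)
Lemma newton_pairing_nat y m :
  newton_pairing y m.+1%:R = \sum_(0 <= n < m.+1) y n * newton_prod m.+1%:R n.
Proof.
apply: csum_finite => n mn; rewrite /newton_prod.
rewrite (big_cat_nat (leq0n m) (ltnW mn))//= [X in _ * (_ * X)]big_ltn//.
by rewrite divff ?pnatr_eq0// subrr mul0r !mulr0.
Qed.

(** The positive integers lie in the half-plane since [kappa < 1]. The values there form a
    triangular system in the [y n], whose diagonal entries [newton_prod m.+1 m] are nonzero. *)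
Lemma newton_pairing_eq0 y :
  (forall w, kappa < complex.Re w -> newton_pairing y w = 0) -> y = 0.
Proof.
move=> y0; suff yn n : y n = 0 by apply/val_inj/funext => n; exact: yn.
elim/ltn_ind: n => m IHm.
have := y0 m.+1%:R; rewrite newton_pairing_nat big_nat_recr//=.
rewrite big_nat big1 ?add0r => [|n /andP[_ nm]]; last by rewrite IHm ?mul0r.
have -> : kappa < complex.Re (m.+1%:R : R[i]).
  rewrite -(rmorph_nat (@real_complex R))/=.
  by apply: lt_le_trans kappa_lt1 _; rewrite ler1n.
move=> /(_ isT) /eqP; rewrite mulf_eq0 => /orP[/eqP//|].
rewrite /newton_prod prodf_seq_eq0 => /hasP[k].
rewrite mem_index_iota => /andP[_ km] /=; rewrite subr_eq0 => /eqP h.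
have : (k.+1%:R : R[i]) = m.+1%:R.
  by move/(congr1 (fun z => z * k.+1%:R)): h; rewrite mul1r divfK ?pnatr_eq0.
by move/eqP; rewrite eqr_nat eqSS (ltn_eqF km).
Qed.

Lemma newton_pairing_identity y w e : kappa < complex.Re w -> 0 < e ->
  (forall s, normc s < e -> newton_pairing y (w + s) = 0) -> y = 0.
Proof.
move=> kw e0 yw; apply: newton_pairing_eq0 => v kv.
apply: (@half_plane_propagation _ _ kappa _ w e) => //.
move=> u r d r0 ru d0 yu.
have [|A [B hA]] := @newton_pairing_taylor y u r r0.
  by move: ru; rewrite !ltrBrDr addrC.
by apply: (power_expansion_vanish r0 d0 hA).
Qed.

End NewtonPairing.

(** * Intertwining operators *)

Section Intertwiner.
Context {R : realType} {p : R} (p1 : 1 < p).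
Local Notation lp := (lp p1).
Local Notation kappa := (1 - p^-1).
Local Notation T := (cesaro_op p1).
Context (X : bounded_op lp) (lambda : R[i])
  (XT : forall f : lp, T (X f) = lambda *: X (T f)).
Implicit Types (f : lp) (w : R[i]).

Let p_gt0 : 0 < p. Proof. exact: lt_trans p1. Qed.

(** This explicit preimage of a multiple of [lp_delta j] turns the intertwining relation into a
    recurrence in [j]. *)
Lemma cesaro_delta j : T (lp_delta p1 j - lp_delta p1 j.+1) =
  j.+1%:R^-1 *: lp_delta p1 j.
Proof.
apply/val_inj/funext => n.
rewrite [LHS](_ : _ = (\sum_(0 <= k < n.+1) ((k == j)%:R - (k == j.+1)%:R)) /
  n.+1%:R)//.
rewrite [RHS](_ : _ = j.+1%:R^-1 * (n == j)%:R)//.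
have -> : \sum_(0 <= k < n.+1) ((k == j)%:R - (k == j.+1)%:R) =
    (n == j)%:R :> R[i].
  elim: n => [|n IHn]; first by rewrite big_nat1 subr0.
  by rewrite big_nat_recr//= IHn eqSS addrCA subrr addr0.
by have [->|_] := eqVneq n j; rewrite ?mul1r ?mulr1// mul0r mulr0.
Qed.

(** By [newton_pairing_cesaro] the difference of the two pairings is [w] times the pairing of
    [T (X (e_j - e_(j+1)))], where [e_j] is [lp_delta j]; by [XT] and [cesaro_delta] this vector is
    [lambda / (j+1)] times [X e_j]. *)
Lemma pairing_deltaS w j : kappa < complex.Re w ->
  newton_pairing (X (lp_delta p1 j.+1)) w =
  newton_pairing (X (lp_delta p1 j)) w * (1 - lambda * w / j.+1%:R).
Proof.
move=> kw.
have := newton_pairing_cesaro (X (lp_delta p1 j - lp_delta p1 j.+1)) kw.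
rewrite XT cesaro_delta linearZ linearB/=.
rewrite -[X in _ = newton_pairing X _]/(_ + - _) -scaleN1r.
rewrite newton_pairingD// !newton_pairingZ//.
set a := newton_pairing _ w; set b := newton_pairing _ w => h.
have -> : b = a - (a + -1 * b) by ring.
by rewrite -h; ring.
Qed.

Lemma pairing_delta w j : kappa < complex.Re w ->
  newton_pairing (X (lp_delta p1 j)) w =
  newton_pairing (X (lp_delta p1 0)) w * newton_prod (lambda * w) j.
Proof.
move=> kw; elim: j => [|j IHj]; first by rewrite /newton_prod big_geq// mulr1.
by rewrite pairing_deltaS// IHj newton_prodS mulrA.
Qed.

Lemma pairing_bounded w : kappa < complex.Re w ->
  exists D, forall f, `|f| <= 1 -> normc (newton_pairing (X f) w) <= D.
Proof.
move=> kw; have [M hM] := op_bounded X.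
have [D hD] := newton_pairing_abs_bound p1 `|M| kw.
exists D => f f1; apply: normc_csum_le; apply: hD.
apply: le_trans (hM f) _; move: f1; rewrite lp_normE -(rmorph1 (@real_complex R)).
rewrite -rmorphM/= !lecR => f1.
apply: (@le_trans _ _ (`|M| * fine (lpnorm p f))).
  by rewrite ler_wpM2r ?ler_norm// fine_ge0// lpnorm_ge0.
by rewrite ler_piMr.
Qed.

Lemma pairing_sum w (a : nat -> R[i]) N : kappa < complex.Re w ->
  newton_pairing (X (\sum_(0 <= j < N) a j *: lp_delta p1 j)) w =
  newton_pairing (X (lp_delta p1 0)) w *
  \sum_(0 <= j < N) a j * newton_prod (lambda * w) j.
Proof.
move=> kw; elim: N => [|N IHN].
  rewrite !big_geq// mulr0 linear0 -(scale0r (0 : lp)) newton_pairingZ//.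
  by rewrite mul0r.
rewrite [in LHS]big_nat_recr// [in RHS]big_nat_recr// linearD linearZ.
by rewrite newton_pairingD// newton_pairingZ// IHN (pairing_delta N kw) mulrDr /=; ring.
Qed.

(* Testing on phases of norm one: the sequence [newton_prod (lambda * w)] decays
   too slowly to represent a bounded functional on [lp]. *)
Lemma pairing_vanish w j : kappa < complex.Re w ->
  complex.Re (lambda * w) < kappa -> newton_pairing (X (lp_delta p1 j)) w = 0.
Proof.
move=> kw lk; rewrite pairing_delta//; set F := newton_pairing _ w.
suff -> : F = 0 by rewrite mul0r.
have [D hD] := pairing_bounded kw.
have k0 : 0 < kappa by rewrite subr_gt0 invf_lt1.
have k1 : kappa < 1 by rewrite ltrBlDr ltrDl invr_gt0.
set mu := lambda * w in lk *.
(* An exponent at least [Re mu] and below [kappa]; the maximum with [kappa / 2] keeps it positive,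
   as [newton_prod_lower] requires. *)
pose s := Num.max (complex.Re mu) (kappa / 2).
have s0 : 0 < s by rewrite /s lt_max divr_gt0 ?orbT.
have sk : s < kappa by rewrite /s gt_max lk ltr_pdivrMr//= ltr_pMr// ltr1n.
have s1 : s < 1 by exact: lt_trans k1.
have mus : complex.Re mu <= s by rewrite /s le_max lexx.
have lower N j' : (j' < N)%N -> (1 - s) * N%:R `^ (- s) <= normc (newton_prod mu j').
  case: N => // N; case: j' => [_|j' jN].
    rewrite /newton_prod big_geq// Normc.normc1 mulr_ile1 ?powR_ge0 ?subr_ge0 ?(ltW s1)//.
      by rewrite gerBl ltW.
    by rewrite powRN invf_le1 ?powR_gt0// -[leLHS](powRr0 N.+1%:R) ler_powR ?ler1n ?ltW.
  apply: le_trans (newton_prod_lower j' s0 s1 mus).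
  rewrite ler_wpM2l ?subr_ge0 ?(ltW s1)// !powRN lef_pV2 ?posrE ?powR_gt0//.
  by apply: ge0_ler_powR; rewrite ?nnegrE ?(ltW s0)// ler_nat ltnW.
(* Up to the factor [1 - s], the test vector yields [N] terms of size at least [N^(-1/p) N^(-s)];
   they add up to [N^(kappa - s)], which is unbounded. *)
have key N : (0 < N)%N -> normc F * (1 - s) * N%:R `^ (kappa - s) <= D.
  move=> N0; have Nr0 : 0 < N%:R :> R by rewrite ltr0n.
  (* Conjugate phases, scaled so that [N] entries of modulus at most [N^(-1/p)] have norm at most 1;
     where the product is zero, division by zero makes the entry zero. *)
  pose th i : R[i] :=
    (N%:R `^ (- p^-1) * normc (newton_prod mu i))%:C%C / newton_prod mu i.
  have thn i : normc (th i) <= N%:R `^ (- p^-1).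
    rewrite Normc.normcM Normc.normcV normc_real.
    rewrite ger0_norm ?mulr_ge0 ?powR_ge0 ?normc_ge0//.
    have [->|h] := eqVneq (normc (newton_prod mu i)) 0.
      by rewrite mulr0 mul0r powR_ge0.
    by rewrite mulfK.
  have thg i : th i * newton_prod mu i =
      (N%:R `^ (- p^-1) * normc (newton_prod mu i))%:C%C.
    rewrite /th; have [->|h] := eqVneq (newton_prod mu i) 0.
      by rewrite Normc.normc0 !mulr0.
    by rewrite divfK.
  have norm1 : `|\sum_(0 <= i < N) th i *: lp_delta p1 i| <= 1.
    have -> : 1 = ((1 : R) `^ p^-1)%:C%C by rewrite powR1 rmorph1.
    apply: lp_norm_le => // m.
    apply: (@le_trans _ _ (\sum_(0 <= n < m) if (n < N)%N then N%:R^-1 else 0)).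
      apply: ler_sum => n _; rewrite lp_delta_sum.
      case: ifP => _; last by rewrite Normc.normc0 powR0 ?gt_eqF.
      apply: (@le_trans _ _ ((N%:R `^ (- p^-1)) `^ p)).
        apply: ge0_ler_powR; rewrite ?nnegrE ?normc_ge0 ?powR_ge0 ?(ltW p_gt0)//.
      by rewrite -powRrM mulNr mulVf ?gt_eqF// powR_inv1.
    apply: (@le_trans _ _ (\sum_(0 <= n < m + N) if (n < N)%N then N%:R^-1 else 0)).
      rewrite [leRHS](big_cat_nat (leq0n m) (leq_addr _ _))//= lerDl.
      by apply: sumr_ge0 => n _; case: ifP => _ //; rewrite invr_ge0 ltW.
    rewrite (big_cat_nat (leq0n N) (leq_addl _ _))//=.
    rewrite [X in _ + X]big_nat [X in _ + X]big1 ?addr0; last first.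
      by move=> n /andP[Nn _]; rewrite ltnNge Nn.
    rewrite big_nat (eq_bigr (fun=> N%:R^-1)); last by move=> n /= ->.
    by rewrite -big_nat sumr_const_nat subn0 -[leLHS]mulr_natl divff// gt_eqF.
  apply: le_trans (hD _ norm1); rewrite pairing_sum// Normc.normcM -mulrA.
  rewrite ler_wpM2l ?normc_ge0//.
  under eq_bigr do rewrite thg.
  rewrite -(rmorph_sum (@real_complex R)) normc_real; apply: le_trans (ler_norm _).
  apply: (@le_trans _ _ (\sum_(0 <= i < N) N%:R `^ (- p^-1) * ((1 - s) * N%:R `^ (- s)))).
    rewrite sumr_const_nat subn0 -[leRHS]mulr_natl le_eqVlt; apply/orP; left; apply/eqP.
    have -> : kappa - s = 1 + (- p^-1 + - s) by ring.
    rewrite !powRD ?(gt_eqF Nr0) ?implybT// powRr1 ?(ltW Nr0)//; ring.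
  by apply: ler_sum_nat => i /andP[_ iN]; rewrite ler_wpM2l ?powR_ge0// lower.
apply: Normc.eq0_normc; apply/eqP; rewrite eq_le normc_ge0 andbT leNgt.
apply/negP => F0.
have ks : 0 < kappa - s by rewrite subr_gt0.
have c0 : 0 < normc F * (1 - s) by rewrite mulr_gt0// subr_gt0.
have D0 : 0 <= D.
  by apply: le_trans (key 1 isT); rewrite mulr_ge0 ?powR_ge0// ltW.
(* Chosen so that [x^(kappa - s)] exceeds by 1 the bound [D / (|F| (1 - s))] that [key] imposes. *)
pose x := (D / (normc F * (1 - s)) + 1) `^ (kappa - s)^-1.
pose N := (Num.bound x).+1.
have xN : x < N%:R.
  apply: (@lt_le_trans _ _ (Num.bound x)%:R); last by rewrite ler_nat.
  by apply: archi_boundP; exact: powR_ge0.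
have := key N isT; rewrite mulrC -ler_pdivlMr// leNgt => /negP; apply.
have y0 : 0 <= D / (normc F * (1 - s)) + 1 by rewrite addr_ge0// divr_ge0// ltW.
apply: (@lt_le_trans _ _ (D / (normc F * (1 - s)) + 1)); first by rewrite ltrDl.
rewrite (_ : _ + 1 = x `^ (kappa - s)); last first.
  by rewrite -powRrM (mulVf (lt0r_neq0 ks)) powRr1.
by apply: ge0_ler_powR; rewrite ?nnegrE ?powR_ge0 ?(ltW ks) ?(ltW xN).
Qed.

(** Both strict inequalities persist near [w], so the pairings of each [X (lp_delta j)] vanish on a
    disc and the identity theorem gives [X (lp_delta j) = 0]; density concludes. *)
Lemma intertwiner_eq0 w : kappa < complex.Re w ->
  complex.Re (lambda * w) < kappa -> forall f, X f = 0.
Proof.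
move=> kw lk.
have Xd j : X (lp_delta p1 j) = 0.
  (* The first radius preserves [kappa < Re (w + s)], the second [Re (lambda * (w + s)) < kappa];
     adding 1 covers [lambda = 0]. *)
  pose e := Num.min (complex.Re w - kappa)
    ((kappa - complex.Re (lambda * w)) / (normc lambda + 1)).
  have l0 : 0 < normc lambda + 1 by rewrite ltr_wpDl ?normc_ge0.
  apply: (@newton_pairing_identity _ _ p1 _ w e) => //.
    by rewrite lt_min subr_gt0 kw divr_gt0// subr_gt0.
  move=> s; rewrite lt_min ltr_pdivlMr// => /andP[se1 se2].
  have Rlow : - normc s <= complex.Re s.
    by rewrite lerNl; apply: le_trans (Re_le_normc s); rewrite -normrN ler_norm.
  have Rup : complex.Re (lambda * s) <= normc lambda * normc s.
    by rewrite -Normc.normcM; apply: le_trans (Re_le_normc _); exact: ler_norm.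
  apply: pairing_vanish.
    by rewrite raddfD/=; move: (complex.Re w) (complex.Re s) (normc s) kappa se1 Rlow
       => *; lra.
  rewrite mulrDr raddfD/=; apply: le_lt_trans (lerD (lexx _) Rup) _.
  have := normc_ge0 s; rewrite -ltrBrDl mulrC => ?; apply: le_lt_trans se2.
  by rewrite ler_wpM2l// lerDl.
move=> f; apply/eqP; rewrite -normr_eq0 eq_le normr_ge0 andbT.
have [M hM] := op_bounded X.
rewrite lp_normE -(rmorph0 (@real_complex R)) lecR.
apply/ler_addgt0Pr => d d0; rewrite add0r -lecR -lp_normE.
have M1 : 0 < `|M| + 1 by rewrite ltr_wpDl.
have [|N hN] := lp_truncation_cvg f (e := d / (`|M| + 1)); first by rewrite divr_gt0.
have XS : X (\sum_(0 <= j < N) f j *: lp_delta p1 j) = 0.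
  by rewrite linear_sum big1// => j _; rewrite linearZ/= Xd scaler0.
have -> : X f = X (f - \sum_(0 <= j < N) f j *: lp_delta p1 j).
  by rewrite linearB/= XS subr0.
apply: le_trans (hM _) _; move: hN; rewrite lp_normE.
rewrite -rmorphM/= !lecR => hN.
set g := fine _ in hN *.
have g0 : 0 <= g by rewrite fine_ge0// lpnorm_ge0.
apply: (@le_trans _ _ ((`|M| + 1) * g)).
  by rewrite ler_wpM2r// (le_trans (ler_norm _))// lerDl.
by rewrite mulrC -ler_pdivlMr.
Qed.

End Intertwiner.

(** * Multiplications that preserve a half-plane, and the conclusion *)

Lemma half_plane_preserved {R : realType} (c : R) (lambda : R[i]) :
  0 < c -> c < 1 ->
  (forall w : R[i], c < complex.Re w -> c <= complex.Re (lambda * w)) ->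
  exists r : R, lambda = r%:C%C /\ 1 <= r.
Proof.
case: lambda => a b c0 c1 h.
have b0 : b = 0.
  apply/eqP/negPn/negP => b0.
  (* Multiplication by [lambda] sends [1 + i a / b] to the imaginary axis. *)
  have := h (Complex 1 (a / b)) c1; rewrite /= mulr1 mulrCA divff// mulr1 subrr.
  by rewrite leNgt c0.
exists a; split; first by rewrite b0.
rewrite leNgt; apply/negP => a1.
have [a0|a0] := leP a 0.
  have := h 1 c1; rewrite /= mulr1 mulr0 subr0 => ca.
  by have := lt_le_trans c0 (le_trans ca a0); rewrite ltxx.
have a2 : 0 < 1 + a by rewrite addr_gt0.
(* For [0 < a < 1] the real point [2 c / (1 + a)] lies beyond [c], but its multiple by [a] is
   [2 a c / (1 + a) < c]. *)
have cw : c < c * (2 / (1 + a)).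
  by rewrite ltr_pMr// ltr_pdivlMr// mul1r; lra.
have := h (Complex (c * (2 / (1 + a))) 0) cw; rewrite /= mulr0 subr0 mulrCA.
rewrite ler_pMr// mulrA ler_pdivlMr// mul1r; lra.
Qed.

Theorem corollary5p3 (R : realType) (p : R) (p1 : 1 < p) (lambda : R[i]) :
  extended_eigenvalue (cesaro_op p1) lambda ->
  exists r : R, lambda = r%:C%C /\ 1 <= r.
Proof.
move=> [X [[f Xf] XT]].
have k0 : 0 < 1 - p^-1 by rewrite subr_gt0 invf_lt1// (lt_trans ltr01).
have k1 : 1 - p^-1 < 1 by rewrite ltrBlDr ltrDl invr_gt0 (lt_trans ltr01).
apply: (half_plane_preserved k0 k1) => w kw; rewrite leNgt; apply/negP => lk.
by move/eqP: Xf; apply; exact: (intertwiner_eq0 XT kw lk).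
Qed.
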